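(* Let $R$ be a central reduced ring. Then $R$ is weakly semicommutative.
   Context: All rings are associative with identity, not necessarily commutative. A ring $R$ is called central reduced if every nilpotent element of $R$ is central. A ring $R$ is called weakly semicommutative if for any $a,b\in R$, $ab=0$ implies that $arb$ is a nilpotent element for each $r\in R$. *)

(* Defs.v *)
From mathcomp Require Import all_boot all_algebra.

Set Implicit Arguments.
Unset Strict Implicit.
Unset Printing Implicit Defensive.

Local Open Scope ring_scope.

(* [pzRingType] does not require [1 != 0], so the zero ring is included. *)

Definition nilpotent_elt (R : pzRingType) (x : R) : Prop :=
  exists2 n : nat, (0 < n)%N & x ^+ n = 0.

Definition central_elt (R : pzRingType) (x : R) : Prop :=
  forall y : R, GRing.comm x y.

Definition central_reduced (R : pzRingType) : Prop :=
  forall x : R, nilpotent_elt x -> central_elt x.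

Definition weakly_semicommutative (R : pzRingType) : Prop :=
  forall a b : R, a * b = 0 -> forall r : R, nilpotent_elt (a * r * b).

(* Main.v *)
(* If ab = 0 then (ba)^2 = b(ab)a = 0, so ba is central; hence
   (arb)^2 = ar(ba)rb = a(ba)rrb = (ab)arrb = 0. *)
Require Import Defs.
From mathcomp Require Import all_boot all_algebra.

Theorem proposition2p13 (R : pzRingType) (hR : central_reduced R) :
  weakly_semicommutative R.
Proof.
move=> a b ab0 r.
have ba_central : central_elt (b * a)%R.
  (* Exponent 2 works because [(b * a) * (b * a)] regroups as [b * (a * b) * a], whose middle factor
     vanishes. *)
  apply: hR; exists 2%N => //.
  by rewrite GRing.expr2 GRing.mulrA -(GRing.mulrA b) ab0 GRing.mulr0 GRing.mul0r.
(* Exponent 2 again: squaring [a * r * b] already brings the central factor [b * a] into the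
   middle. *)
exists 2%N => //.
rewrite GRing.expr2 !GRing.mulrA -(GRing.mulrA (a * r)%R b a).
(* Centrality carries [b * a] left across [r] to meet the leading [a], so the product starts with
   [a * b]. *)
rewrite -(GRing.mulrA a r) -(ba_central r) !GRing.mulrA ab0.
by rewrite !GRing.mul0r.
Qed.
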